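(* Let $M=(E,\rho)$ be a $(q,r)$-polymatroid and let $U \leq E$. Then $$\sum_{A:\,A \leq U} p(M^*.A;z) = z^{r\dim(U)-\rho(E)} \sum_{A:\,A \leq U^\perp} p(M.A;z).$$
   Context: $q$ is a prime power, $n,r$ are positive integers, $E$ is an $n$-dimensional $\mathbb{F}_q$-vector space, and $\mathcal{L}(E)$ is the lattice of subspaces of $E$; $\leq$ denotes inclusion of subspaces. A $(q,r)$-polymatroid is a pair $M=(E,\rho)$ with $\rho:\mathcal{L}(E)\to\mathbb{N}_0$ such that for all $A,B\leq E$: (R1) $0\leq\rho(A)\leq r\dim A$; (R2) $A\leq B$ implies $\rho(A)\leq\rho(B)$; (R3) $\rho(A+B)+\rho(A\cap B)\leq\rho(A)+\rho(B)$. Fix an involutory lattice anti-isomorphism $U\mapsto U^\perp$ of $\mathcal{L}(E)$ (an order-reversing bijection interchanging sums and intersections, with $U^{\perp\perp}=U$; hence $\dim U^\perp=n-\dim U$). The dual of $M$ is the $(q,r)$-polymatroid $M^*=(E,\rho^* )$, $\rho^*(A)=r\dim(A)-\rho(E)+\rho(A^\perp)$. For $T\leq E$, the contraction $M/T$ is the $(q,r)$-polymatroid on $E/T$ with rank function $\rho_{M/T}(A/T)=\rho(A)-\rho(T)$ for $T\leq A\leq E$. For $X\leq E$, the contraction of $M$ to $X$ is $M.X:=M/X^\perp$ (likewise $M^*.X:=M^*/X^\perp$). For a $(q,r)$-polymatroid $N$ on a space $F$, put $\ell_N(A)=\rho_N(F)-\rho_N(A)$ for $A\leq F$; its characteristic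 polynomial is $p(N;z)=\sum_{X\leq F}\mu(0,X)z^{\ell_N(X)}\in\mathbb{Z}[z]$, where $\mu$ is the Möbius function of $\mathcal{L}(F)$, i.e. $\mu(U,V)=(-1)^{v-u}q^{\binom{v-u}{2}}$ for $U\leq V$ of dimensions $u,v$. *)

(* Defs.v *)
From HB Require Import structures.
From mathcomp Require Import all_boot all_order all_algebra all_field ring zify.

Set Implicit Arguments.
Unset Strict Implicit.
Unset Printing Implicit Defensive.

Import GRing.Theory VectorInternalTheory.
Local Open Scope ring_scope.
Local Open Scope quotient_scope.

(* The exponent of z in the identity can be negative, so the identity lives in
   {fraction {poly int}}, which contains the Laurent polynomials in z. *)
Notation "x %:F" := (FracField.tofrac x) : ring_scope.

HB.instance Definition _ (F : finFieldType) (E : vectType F) :=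
  [Countable of {vspace E} by <:].
HB.instance Definition _ (F : finFieldType) (E : vectType F) :=
  [Finite of {vspace E} by <:].

Section QuotientSpace.
Variables (F : fieldType) (E : vectType F) (T : {vspace E}).

(* E / T, as the quotient by the relation x - y \in T; the scalar action and
   the finite-dimensional structure are added below. *)
Definition quotv : Type := Quotient.quot (pred_of_vspace T).
HB.instance Definition _ := Quotient.on quotv.
HB.instance Definition _ := EqQuotient.on quotv.
HB.instance Definition _ := GRing.Zmodule.on quotv.

Definition piv (x : E) : quotv := \pi_quotv x.

Lemma piv_eq x y : (piv x == piv y) = (x - y \in T).
Proof. by rewrite /piv -[RHS]Quotient.equivE piE. Qed.

Lemma pivD x y : piv (x + y) = piv x + piv y.
Proof. by rewrite /piv; exact: raddfD (\pi_(Quotient.quot (pred_of_vspace T))) x y. Qed.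

Lemma reprvK (u : quotv) : piv (repr u) = u.
Proof. exact: reprK. Qed.

Definition scalev (a : F) (u : quotv) : quotv := piv (a *: repr u).

Lemma pivZ a x : piv (a *: x) = scalev a (piv x).
Proof.
apply/eqP; rewrite piv_eq -scalerBr rpredZ // -piv_eq; apply/eqP.
by rewrite reprvK.
Qed.

Fact scalevA a b u : scalev a (scalev b u) = scalev (a * b) u.
Proof. by rewrite -[u]reprvK -!pivZ scalerA. Qed.
Fact scale1v : left_id 1 scalev.
Proof. by move=> u; rewrite -[u]reprvK -!pivZ scale1r. Qed.
Fact scalevDr : right_distributive scalev +%R.
Proof.
by move=> a u v; rewrite -[u]reprvK -[v]reprvK -!(pivZ, pivD) scalerDr.
Qed.
Fact scalevDl u : {morph scalev^~ u : a b / a + b}.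
Proof. by move=> a b; rewrite -[u]reprvK -!(pivZ, pivD) scalerDl. Qed.

HB.instance Definition _ := GRing.Zmodule_isLmodule.Build F quotv
  scalevA scale1v scalevDr scalevDl.

Fact piv_is_linear : linear piv.
Proof. by move=> a x y; rewrite pivD pivZ. Qed.
HB.instance Definition _ := GRing.isLinear.Build F E quotv _ piv piv_is_linear.

Fact quotv_vect_axiom : vector_axiom_def (dim (subvs_of T^C)) quotv.
Proof.
have capCT : (T^C :&: T = 0)%VS by rewrite capvC capv_compl.
pose p := daddv_pi T^C T; pose g (x : E) : subvs_of T^C := vsproj T^C (p x).
have ling : linear g by move=> a x y; rewrite /g !linearP.
have gB x y : g (x - y) = g x - g y by rewrite /g !linearB.
have g_eq x y : (g x == g y) = (x - y \in T).
  rewrite -subr_eq0 -gB; have := memvf (x - y); move: {x y}(x - y) => x.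
  rewrite -(addv_complf T) addvC => /(daddv_pi_add capCT) xE.
  have p0 : (g x == 0) = (p x == 0).
    by rewrite -(inj_eq val_inj) /= vsprojK ?memv_pi.
  rewrite p0; apply/eqP/idP => [px0|xT].
    by rewrite -xE -/p px0 add0r memv_pi.
  by apply/eqP; rewrite -memv0 -capCT memv_cap memv_pi -[p x](addrK (daddv_pi T T^C x)) xE rpredB ?memv_pi.
have gpi x : g (repr (piv x)) = g x.
  by apply/eqP; rewrite g_eq -piv_eq reprvK.
exists (fun u => v2r (g (repr u))) => [a u v|].
  rewrite -linearP; congr (v2r _).
  by rewrite -{1}[u]reprvK -{1}[v]reprvK -linearP gpi ling.
exists (fun r => piv (vsval (r2v r))) => [u|r].
  rewrite v2rK -[RHS]reprvK; apply/eqP; rewrite piv_eq -g_eq.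
  by rewrite /g -[X in _ == X]vsvalK; apply/eqP; congr vsproj;
     rewrite /p vsprojK ?memv_pi // daddv_pi_id ?memv_pi.
rewrite gpi /g /p daddv_pi_id ?subvsP // vsvalK; exact: r2vK.
Qed.
HB.instance Definition _ := Lmodule_hasFinDim.Build F quotv quotv_vect_axiom.

Definition pilin : 'Hom(E, quotv) := linfun piv.

Lemma limg_pilin : limg pilin = fullv.
Proof.
apply/vspaceP => u.
by rewrite memvf -[u]reprvK -(lfunE piv) memv_img ?memvf.
Qed.

Lemma lker_pilin : lker pilin = T.
Proof.
by apply/vspaceP => x; rewrite memv_ker lfunE /= -(linear0 piv) piv_eq subr0.
Qed.
End QuotientSpace.

Section Mobius.
Variables (F : finFieldType) (E : vectType F).
Implicit Types U V W X Y : {vspace E}.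

(* [k] bounds the recursion depth; every k >= \dim V gives the same value. *)
Fixpoint mobius_rec (k : nat) U V : int :=
  if U == V then 1 else
  if k is k'.+1 then
    - \sum_(X : {vspace E} | [&& (U <= X)%VS, (X <= V)%VS & X != V])
        mobius_rec k' U X
  else 0.

(* The Moebius function of the finite lattice {vspace E}, by its defining
   recursion (mobiusE); mobius_formula gives its closed form. *)
Definition mobius U V : int := mobius_rec (\dim V) U V.

Lemma dimv_lt U V : (U <= V)%VS -> U != V -> (\dim U < \dim V)%N.
Proof.
by move=> sUV neUV; have [leUV eqUV] := dimv_leqif_eq sUV; rewrite ltn_neqAle eqUV neUV.
Qed.

Lemma mobius_rec_dim k U V : (\dim V <= k)%N -> mobius_rec k U V = mobius U V.
Proof.
rewrite /mobius; move: (leqnn (\dim V)); move: {2 4}(\dim V) => k'.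
elim: k k' V => [|k IHk] [|k'] V dV dV' //=; case: ifP => // neUV.
- have V0: V = 0%VS by apply/eqP; rewrite -dimv_eq0 -leqn0.
  rewrite big1 ?oppr0 // => X /and3P[_ sXV]; rewrite V0 in sXV *.
  by rewrite -subv0 sXV.
- have V0: V = 0%VS by apply/eqP; rewrite -dimv_eq0 -leqn0.
  rewrite big1 ?oppr0 // => X /and3P[_ sXV]; rewrite V0 in sXV *.
  by rewrite -subv0 sXV.
congr (- _); apply: eq_bigr => X /and3P[_ sXV neXV].
have dX := dimv_lt sXV neXV.
by apply: IHk; rewrite -ltnS (leq_trans dX).
Qed.

Lemma mobiusE U V : mobius U V =
  if U == V then 1 else
  - \sum_(X : {vspace E} | [&& (U <= X)%VS, (X <= V)%VS & X != V]) mobius U X.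
Proof.
rewrite -(@mobius_rec_dim (\dim V).+1) //=; case: ifP => // _; congr (- _).
by apply: eq_bigr => X /and3P[_ sXV _]; rewrite mobius_rec_dim ?dimvS.
Qed.

Lemma sum_mobius U V : (U <= V)%VS ->
  \sum_(X : {vspace E} | (U <= X)%VS && (X <= V)%VS) mobius U X = (U == V)%:R.
Proof.
move=> sUV; rewrite (bigD1 V) ?sUV ?subvv //= mobiusE.
have [<-|_] := eqVneq U V.
  rewrite big1 ?addr0 // => X /andP[/subv_anti-> ].
  by rewrite eqxx.
by apply/eqP; rewrite addrC subr_eq0; apply/eqP/eq_bigl => X; rewrite andbA.
Qed.

Lemma hyperplane_between U V : (U <= V)%VS -> U != V ->
  exists W, [/\ (U <= W)%VS, (W <= V)%VS & \dim V = (\dim W).+1].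
Proof.
move: {-1}(\dim V - \dim U)%N (leqnn (\dim V - \dim U)) => d.
elim: d U => [|d IHd] U dUV sUV neUV; have dlt := dimv_lt sUV neUV.
  by lia.
have /subvPn[v Vv Uv]: ~~ (V <= U)%VS.
  by apply: contra neUV => sVU; rewrite eqEsubv sUV.
have sUU : (U <= U + <[v]>)%VS by apply: addvSl.
have sU'V : (U + <[v]> <= V)%VS by rewrite subv_add sUV -memvE.
have dU' : (\dim (U + <[v]>) <= (\dim U).+1)%N.
  have := (dimv_add_leqif U <[v]>).1; rewrite dim_vline; case: (v != 0) => /=; lia.
have neUU : U != (U + <[v]>)%VS.
  by apply: contra Uv => /eqP->; rewrite memvE addvSr.
have dU'2 := dimv_lt sUU neUU.
have [U'V|neU'V] := eqVneq (U + <[v]>)%VS V.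
  by exists U; split; rewrite -?U'V //; lia.
have [||//|W [sUW sWV dW]] := IHd (U + <[v]>)%VS; [by lia|by []|].
by exists W; split=> //; apply: subv_trans sUW.
Qed.

Lemma addv_hyperplane W V X : (W <= V)%VS -> \dim V = (\dim W).+1 ->
  (X <= V)%VS -> ~~ (X <= W)%VS -> (X + W)%VS = V.
Proof.
move=> sWV dV sXV nXW; apply/eqP; rewrite eqEdim subv_add sXV sWV dV /=.
apply: dimv_lt; first exact: addvSr.
by apply: contra nXW => /eqP->; apply: addvSl.
Qed.

Lemma card_hyperplane_compl W V Y :
    (W <= V)%VS -> \dim V = (\dim W).+1 -> (Y <= W)%VS ->
  #|[pred X : {vspace E} | [&& (X <= V)%VS, ~~ (X <= W)%VS & X :&: W == Y]%VS]|
    = (#|F| ^ (\dim W - \dim Y))%N.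
Proof.
move=> sWV dV sYW; set P := [pred X | _].
have /subvPn[v0 Vv0 Wv0]: ~~ (V <= W)%VS.
  by apply/negP => /dimvS; rewrite dV ltnn.
have dimP X : X \in P -> \dim X = (\dim Y).+1.
  move=> /and3P[sXV nXW /eqP XWY]; have := dimv_sum_cap X W.
  rewrite (addv_hyperplane sWV) // XWY dV; lia.
pose D := (W :\: Y)%VS.
have sDW : (D <= W)%VS by apply: diffvSl.
pose g (d : E) : {vspace E} := (Y + <[v0 + d]>)%VS.
have gP d : d \in D -> g d \in P.
  move=> /(subvP sDW) Wd; have sYV := subv_trans sYW sWV.
  have nW : ~~ (g d <= W)%VS.
    by rewrite subv_add sYW -memvE; apply: contra Wv0 => Wvd; rewrite -(addrK d v0) rpredB.
  have sV : (g d <= V)%VS by rewrite subv_add sYV -memvE rpredD // (subvP sWV).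
  rewrite inE sV nW /= eq_sym eqEdim subv_cap addvSl sYW /=.
  have := dimv_sum_cap (g d) W; rewrite (addv_hyperplane sWV) // dV.
  have := (dimv_add_leqif Y <[v0 + d]>).1; rewrite dim_vline -/(g d).
  by case: (v0 + d != 0) => /=; lia.
pose e (c : 'rV[F]_(dim (subvs_of D))) : E := vsval (r2v c : subvs_of D).
have eD c : e c \in D by apply: subvsP.
have <- : #|{: 'rV[F]_(dim (subvs_of D))}| = (#|F| ^ (\dim W - \dim Y))%N.
  rewrite card_mx mul1n [dim _](_ : _ = \dim D) // -(dimv_cap_compl W Y) (capv_idPr sYW).
  by rewrite addKn.
have injg : {in D &, injective g}.
  move=> d d' Dd Dd' gdd'; apply/eqP; rewrite -subr_eq0 -memv0.
  rewrite -(capv_diff W Y) memv_cap rpredB //=.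
  have /and3P[_ _ /eqP <-] := gP d Dd.
  have Wdd' : d - d' \in W by rewrite rpredB ?(subvP sDW).
  rewrite memv_cap Wdd' andbT.
  have -> : d - d' = (v0 + d) - (v0 + d') by rewrite opprD addrACA subrr add0r.
  have gd x : v0 + x \in g x by rewrite memvE addvSr.
  by rewrite rpredB ?gd // gdd' gd.
have injge : injective (g \o e).
  by move=> c c' /injg; move/(_ (eD c) (eD c'))/val_inj/r2v_inj.
rewrite -(card_imset _ injge); apply: eq_card => X; apply/idP/imsetP; last first.
  by case=> c _ ->; apply: gP.
move=> PX; have /and3P[sXV nXW /eqP XWY] := PX.
have sYX : (Y <= X)%VS by rewrite -XWY capvSl.
have: v0 \in (X + W)%VS by rewrite (addv_hyperplane sWV).
case/memv_addP => x Xx [w Ww v0E].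
have: w \in (W :\: Y + W :&: Y)%VS by rewrite addv_diff_cap.
case/memv_addP => d Dd [y]; rewrite (capv_idPr sYW) => Yy wE.
have DNd : - d \in D by rewrite rpredN.
have eE : e (v2r (vsproj D (- d))) = - d by rewrite /e v2rK vsprojK.
exists (v2r (vsproj D (- d))) => //=; rewrite eE.
apply/esym/eqP; rewrite eqEdim (dimP _ PX) (dimP _ (gP _ DNd)).
rewrite leqnn andbT subv_add sYX -memvE v0E wE.
by rewrite [d + y]addrC addrA addrK rpredD // (subvP sYX).
Qed.

Let f (k : nat) : int := (-1) ^+ k * (#|F| ^ 'C(k, 2))%:R.

Lemma sum_mobius_formula U V : (U <= V)%VS ->
  \sum_(X : {vspace E} | (U <= X)%VS && (X <= V)%VS) f (\dim X - \dim U)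
    = (U == V)%:R.
Proof.
elim: {V}(\dim V) {-2}V (leqnn (\dim V)) => [|d IHd] V dV sUV.
  have V0: V = 0%VS by apply/eqP; rewrite -dimv_eq0 -leqn0.
  have U0: U = 0%VS by apply/eqP; rewrite -subv0 -V0.
  rewrite V0 U0 eqxx (big_pred1 0%VS) => [|X].
    by rewrite subnn /f bin0n mul1r.
  by rewrite sub0v subv0.
have [UV|neUV] := eqVneq U V.
  rewrite -UV (big_pred1 U) => [|X]; last by rewrite /= eqEsubv andbC.
  by rewrite subnn /f bin0n mul1r.
have [W [sUW sWV dW]] := hyperplane_between sUV neUV.
rewrite (bigID (fun X => (X <= W)%VS)) /=.
pose S := \sum_(Y : {vspace E} | (U <= Y)%VS && (Y <= W)%VS) f (\dim Y - \dim U).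
have -> : \sum_(X : {vspace E} | ((U <= X)%VS && (X <= V)%VS) && (X <= W)%VS)
    f (\dim X - \dim U) = S.
  apply: eq_bigl => X; rewrite -andbA; congr (_ && _).
  by apply: andb_idl => /subv_trans; apply.
rewrite (partition_big (fun X => (X :&: W)%VS)
           (fun Y => (U <= Y)%VS && (Y <= W)%VS)) /=; last first.
  by move=> X /andP[/andP[sUX _] _]; rewrite subv_cap sUX sUW capvSr.
have -> : \sum_(Y : {vspace E} | (U <= Y)%VS && (Y <= W)%VS)
    \sum_(X : {vspace E} | (((U <= X)%VS && (X <= V)%VS) && ~~ (X <= W)%VS)
                          && ((X :&: W)%VS == Y)) f (\dim X - \dim U)
    = \sum_(Y : {vspace E} | (U <= Y)%VS && (Y <= W)%VS)
        - (#|F| ^ (\dim W - \dim U))%:R * f (\dim Y - \dim U).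
  apply: eq_bigr => Y /andP[sUY sYW].
  have dUY := dimvS sUY; have dYW := dimvS sYW.
  rewrite (eq_bigl [pred X : {vspace E} |
     [&& (X <= V)%VS, ~~ (X <= W)%VS & X :&: W == Y]%VS]); last first.
    move=> X /=; rewrite -!andbA; apply: andb_idl => /and3P[_ _ /eqP XWY].
    by apply: subv_trans sUY _; rewrite -XWY capvSl.
  rewrite (eq_bigr (fun _ => f (\dim Y - \dim U).+1)); last first.
    move=> X /and3P[sXV nXW /eqP XWY]; congr f.
    have := dimv_sum_cap X W; rewrite (addv_hyperplane sWV) // XWY dW; lia.
  rewrite sumr_const (card_hyperplane_compl sWV) // /f binS bin1 expnD exprS.
  have -> : (\dim W - \dim U = (\dim W - \dim Y) + (\dim Y - \dim U))%N by lia.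
  by rewrite expnD -mulr_natr !natrM; ring.
rewrite -big_distrr /= -/S /S IHd //; last by lia.
have [<-|_] := eqVneq U W; first by rewrite subnn expn0; ring.
by rewrite mulr0 addr0.
Qed.

Lemma mobius_formula U V : (U <= V)%VS ->
  mobius U V =
    (-1) ^+ (\dim V - \dim U) * (#|F| ^ 'C(\dim V - \dim U, 2))%:R.
Proof.
rewrite -/(f _); elim: {V}(\dim V) {-2}V (leqnn (\dim V)) => [|d IHd] V dV sUV.
all: have := sum_mobius sUV; rewrite -(sum_mobius_formula sUV).
all: rewrite (bigD1 V) ?sUV ?subvv //= [RHS](bigD1 V) ?sUV ?subvv //=.
all: rewrite (eq_bigr (fun X => f (\dim X - \dim U))) => [/addIr //|X].
all: move=> /andP[/andP[sUX sXV] neXV]; have := dimv_lt sXV neXV => dXV.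
  by lia.
by apply: IHd => //; lia.
Qed.
End Mobius.

(* A (q,r)-polymatroid on E, where q = #|F|. *)
Record polymatroid (F : finFieldType) (r : nat) (E : vectType F) := Polymatroid {
  rank :> {vspace E} -> nat;
  rank_le_dim : forall A, (rank A <= r * \dim A)%N;
  rank_mono : forall A B, (A <= B)%VS -> (rank A <= rank B)%N;
  rank_submod : forall A B,
    (rank (A + B)%VS + rank (A :&: B)%VS <= rank A + rank B)%N
}.

(* An involutory lattice anti-isomorphism of the subspace lattice; that it
   interchanges sums and intersections follows (perpD, perpI). *)
Record antiautomorphism (F : fieldType) (E : vectType F) := Antiautomorphism {
  perp :> {vspace E} -> {vspace E};
  perpK : involutive perp;
  perpS : forall A B, (A <= B)%VS -> (perp B <= perp A)%VS
}.

Section Perp.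
Variables (F : fieldType) (E : vectType F) (p : antiautomorphism E).
Implicit Types A B : {vspace E}.

Lemma perpD A B : p (A + B)%VS = (p A :&: p B)%VS.
Proof.
apply/eqP; rewrite eqEsubv subv_cap !perpS ?addvSl ?addvSr //=.
rewrite -[X in (X <= _)%VS](perpK p); apply: perpS.
by rewrite subv_add -{1}[A](perpK p) -{2}[B](perpK p) !perpS ?capvSl ?capvSr.
Qed.

Lemma perpI A B : p (A :&: B)%VS = (p A + p B)%VS.
Proof. by rewrite -[RHS](perpK p) perpD !perpK. Qed.

Lemma dim_perp_ge d A : (d <= \dim {:E} - \dim A -> d <= \dim (p A))%N.
Proof.
elim: d A => [|d IHd] A dA //.
have /subvPn[v _ Av]: ~~ ({:E} <= A)%VS by apply/negP => /dimvS; lia.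
have sAA : (A <= A + <[v]>)%VS by apply: addvSl.
have neA : (p (A + <[v]>) != p A)%VS.
  apply: contra Av => /eqP/(inv_inj (perpK p)) eqA.
  by rewrite memvE -eqA addvSr.
have [le_d eq_d] := dimv_leqif_eq (perpS p sAA).
have lt_d : (\dim (p (A + <[v]>)%VS) < \dim (p A))%N.
  by rewrite ltn_neqAle eq_d neA.
have := (dimv_add_leqif A <[v]>).1; rewrite dim_vline => dAv.
have : (d <= \dim (p (A + <[v]>)%VS))%N.
  by apply: IHd; move: dAv; case: (v != 0) => /=; lia.
lia.
Qed.

Lemma dim_perp_le d A : (\dim A <= d -> \dim (p A) <= \dim {:E} - \dim A)%N.
Proof.
elim: d A => [|d IHd] A dA.
  by have := dimvS (subvf (p A)); lia.
have [A0|/negPf A0] := eqVneq A 0%VS.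
  by rewrite A0 dimv0 subn0 dimvS ?subvf.
pose v := vpick A; pose B := (A :\: <[v]>)%VS.
have sBA : (B <= A)%VS by apply: diffvSl.
have dB : (\dim A = (\dim B).+1)%N.
  have := dimv_cap_compl A <[v]>; rewrite (capv_idPr _) -?memvE ?memv_pick //.
  by rewrite dim_vline vpick0 A0 -/B /=; lia.
have neB : (p A != p B)%VS.
  by apply/eqP => /(inv_inj (perpK p)) AB; rewrite AB in dB; lia.
have [le_d eq_d] := dimv_leqif_eq (perpS p sBA).
have lt_d : (\dim (p A) < \dim (p B))%N by rewrite ltn_neqAle eq_d neB.
have : (\dim (p B) <= \dim {:E} - \dim B)%N by apply: IHd; lia.
by lia.
Qed.

Lemma dim_perp A : \dim (p A) = (\dim {:E} - \dim A)%N.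
Proof.
by apply/eqP; rewrite eqn_leq (dim_perp_le (leqnn _)) (dim_perp_ge (leqnn _)).
Qed.
End Perp.

Section PolymatroidTheory.
Variables (F : finFieldType) (r : nat) (E : vectType F) (M : polymatroid r E).
Implicit Types A B T : {vspace E}.

Lemma rank_extend A B : (A <= B)%VS ->
  (M B <= M A + r * (\dim B - \dim A))%N.
Proof.
move=> sAB; have := dimv_cap_compl B A; rewrite (capv_idPr sAB) => <-.
rewrite addKn; have := rank_submod M (B :\: A)%VS A.
rewrite addv_diff (addv_idPl sAB).
by have := rank_le_dim M (B :\: A)%VS; lia.
Qed.

Section Dual.
Variable p : antiautomorphism E.

Lemma dual_rank_ge A : (M fullv <= r * \dim A + M (p A))%N.
Proof.
have := rank_extend (subvf (p A)).
by rewrite dim_perp subKn ?dimvS ?subvf // addnC.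
Qed.

(* No truncation occurs in this subtraction, by dual_rank_ge. *)
Definition dual_rank A : nat := (r * \dim A + M (p A) - M fullv)%N.

Lemma dual_rankE A :
  (dual_rank A)%:Z = (r * \dim A)%:Z - (M fullv)%:Z + (M (p A))%:Z.
Proof. by have := dual_rank_ge A; rewrite /dual_rank; lia. Qed.

Fact dual_rank_le_dim A : (dual_rank A <= r * \dim A)%N.
Proof. by have := rank_mono M (subvf (p A)); rewrite /dual_rank; lia. Qed.

Fact dual_rank_mono A B : (A <= B)%VS -> (dual_rank A <= dual_rank B)%N.
Proof.
move=> sAB; rewrite /dual_rank leq_sub2r //.
have := rank_extend (perpS p sAB); rewrite !dim_perp.
have -> : (\dim {:E} - \dim A - (\dim {:E} - \dim B) = \dim B - \dim A)%N.
  by have := dimvS (subvf B); lia.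
have : (r * \dim A <= r * \dim B)%N by rewrite leq_mul2l dimvS // orbT.
by rewrite mulnBr; lia.
Qed.

Fact dual_rank_submod A B :
  (dual_rank (A + B)%VS + dual_rank (A :&: B)%VS
     <= dual_rank A + dual_rank B)%N.
Proof.
have := rank_submod M (p A) (p B); rewrite -perpD -perpI.
have := congr1 (muln r) (dimv_sum_cap A B); rewrite !mulnDr.
have := dual_rank_ge A; have := dual_rank_ge B.
have := dual_rank_ge (A + B)%VS; have := dual_rank_ge (A :&: B)%VS.
by rewrite /dual_rank; lia.
Qed.

Definition dual : polymatroid r E :=
  Polymatroid dual_rank_le_dim dual_rank_mono dual_rank_submod.
End Dual.

Section Contraction.
Variable T : {vspace E}.
Implicit Types C D : {vspace (quotv T)}.

Definition pull C : {vspace E} := (pilin T @^-1: C)%VS.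

Lemma sub_pull C : (T <= pull C)%VS.
Proof. by rewrite -{1}(lker_pilin T) -lpreim0 lpreimS ?sub0v. Qed.

Lemma pullK C : (pilin T @: pull C)%VS = C.
Proof. by rewrite lpreimK // limg_pilin subvf. Qed.

Lemma imgK A : (T <= A)%VS -> pull (pilin T @: A) = A.
Proof.
move=> sTA; apply/vspaceP => x; rewrite -memv_preim; apply/idP/idP; last first.
  exact: memv_img.
case/memv_imgP => y Ay /eqP; rewrite -subr_eq0 -linearB -memv_ker lker_pilin.
by move=> /(subvP sTA) Axy; rewrite -(subrK y x) rpredD.
Qed.

Lemma pullD C D : pull (C + D) = (pull C + pull D)%VS.
Proof.
have sT : (T <= pull C + pull D)%VS.
  exact: subv_trans (sub_pull C) (addvSl _ _).
by rewrite -[RHS](imgK sT) (limgD _ (pull C)) !pullK.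
Qed.

Lemma pullI C D : pull (C :&: D) = (pull C :&: pull D)%VS.
Proof.
by apply/vspaceP => x; rewrite memv_cap -!memv_preim memv_cap.
Qed.

Lemma dim_pull C : \dim (pull C) = (\dim T + \dim C)%N.
Proof.
have := limg_ker_dim (pilin T) (pull C).
by rewrite pullK lker_pilin (capv_idPr (sub_pull C)).
Qed.

(* Every subspace of E / T is A / T for a unique A containing T, namely its
   preimage; contraction_rankE is the usual formula. *)
Definition contraction_rank C : nat := (M (pull C) - M T)%N.

Lemma contraction_rankE A : (T <= A)%VS ->
  contraction_rank (pilin T @: A) = (M A - M T)%N.
Proof. by move=> sTA; rewrite /contraction_rank imgK. Qed.

Fact contraction_rank_le_dim C : (contraction_rank C <= r * \dim C)%N.
Proof.
have := rank_extend (sub_pull C); rewrite dim_pull addKn /contraction_rank.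
by lia.
Qed.

Fact contraction_rank_mono C D :
  (C <= D)%VS -> (contraction_rank C <= contraction_rank D)%N.
Proof. by move=> sCD; rewrite leq_sub2r // rank_mono // lpreimS. Qed.

Fact contraction_rank_submod C D :
  (contraction_rank (C + D)%VS + contraction_rank (C :&: D)%VS
     <= contraction_rank C + contraction_rank D)%N.
Proof.
rewrite /contraction_rank pullD pullI.
have := rank_submod M (pull C) (pull D); rewrite -pullD -pullI.
have := rank_mono M (sub_pull C); have := rank_mono M (sub_pull D).
have := rank_mono M (sub_pull (C + D)%VS).
have := rank_mono M (sub_pull (C :&: D)%VS).
by lia.
Qed.

Definition contraction : polymatroid r (quotv T) :=
  Polymatroid contraction_rank_le_dim contraction_rank_mono
              contraction_rank_submod.
End Contraction.

Definition contraction_to (p : antiautomorphism E) (X : {vspace E}) :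
  polymatroid r (quotv (p X)) := contraction (p X).

Definition corank A : nat := (M fullv - M A)%N.

Definition characteristic_poly : {poly int} :=
  \sum_(X : {vspace E}) (mobius 0 X)%:P * 'X^(corank X).
End PolymatroidTheory.

(* Main.v *)
Require Import Defs.
From mathcomp Require Import all_boot all_order all_algebra all_field.
From mathcomp Require Import zify.

(** Both sides collapse to a single power of [z].  Since a subspace of [E / T]
    is a subspace of [E] above [T], with the same Moebius values and coranks,
    [p(M / T; z)] is the sum of [mu(T, X) z^(l(X))] over [X >= T], where
    [l(X) = rho(E) - rho(X)] ([characteristic_poly_contraction]).  Summing over
    all [T = A^perp] with [A <= U] means summing over all [T >= U^perp], and
    Moebius inversion leaves only the term [X = U^perp]:

      sum_(A <= U) p(M.A; z) = z^(rho(E) - rho(U^perp))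

    ([sum_characteristic_poly_contraction_to]).  Applying this to [M^*] and [U]
    on the left, and to [M] and [U^perp] on the right, reduces the identity to
    [rho^*(E) - rho^*(U^perp) = r dim U - rho(U)], which comes from the
    definition of [rho^*] and [rho(0) = 0] ([corank_dual_perp]). *)

Import GRing.Theory.
Local Open Scope ring_scope.

Section MobiusInversion.
Set Implicit Arguments.
Variables (F : finFieldType) (E : vectType F).
Implicit Types U V T X : {vspace E}.

(** The interval of subspaces of [E / T] below [C] is the interval from [T] to
    the preimage of [C]; the closed form, which sees only the length of an
    interval, spares the transport along this isomorphism. *)
Lemma mobius_quotient T (C : {vspace quotv T}) :
  mobius 0 C = mobius T (pull C).
Proof.
by rewrite !mobius_formula ?sub0v ?sub_pull // dim_pull addKn dimv0 subn0.
Qed.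

Lemma mobius_perp (p : antiautomorphism E) U V : (U <= V)%VS ->
  mobius (p V) (p U) = mobius U V.
Proof.
move=> sUV; rewrite !mobius_formula ?perpS // !dim_perp.
have -> // : (\dim {:E} - \dim U - (\dim {:E} - \dim V) = \dim V - \dim U)%N.
by have := dimvS sUV; have := dimvS (subvf V); lia.
Qed.

(** The Moebius function is defined by summing over the upper end of an
    interval; the anti-automorphism turns that recursion into the sum over the
    lower end, the variable that ranges over the contracted subspaces. *)
Lemma sum_mobius_lower (p : antiautomorphism E) U X : (U <= X)%VS ->
  \sum_(T : {vspace E} | (U <= T)%VS && (T <= X)%VS) mobius T X = (U == X)%:R.
Proof.
move=> sUX; rewrite -(inj_eq (inv_inj (perpK p))) eq_sym.
rewrite -(sum_mobius (perpS p sUX)) (reindex_inj (inv_inj (perpK p))) /=.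
have le_perp (A B : {vspace E}) : (A <= p B)%VS = (B <= p A)%VS.
  by apply/idP/idP => /(perpS p); rewrite perpK.
apply: eq_big => [T|T /andP[_ sTX]].
  rewrite le_perp andbC; congr (_ && _).
  by rewrite -{1}[X](perpK p) le_perp perpK.
by rewrite -(mobius_perp p sTX) perpK.
Qed.

End MobiusInversion.

Section CharacteristicPoly.
Variables (F : finFieldType) (r : nat) (E : vectType F) (M : polymatroid r E).
Implicit Types A T U : {vspace E}.

Lemma corank_contraction T (C : {vspace quotv T}) :
  corank (contraction M T) C = corank M (pull C).
Proof.
rewrite /corank /= /contraction_rank.
have -> : pull (fullv : {vspace quotv T}) = fullv.
  by rewrite -(limg_pilin T) imgK ?subvf.
by have := rank_mono M (sub_pull C); lia.
Qed.

Lemma characteristic_poly_contraction T :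
  characteristic_poly (contraction M T) =
  \sum_(X : {vspace E} | (T <= X)%VS) (mobius T X)%:P * 'X^(corank M X).
Proof.
rewrite (reindex (@pull _ _ T)) /=; last first.
  exists (fun A => pilin T @: A)%VS => [C _|A]; first exact: pullK.
  by rewrite inE; apply: imgK.
apply: eq_big => [C|C _]; first by rewrite sub_pull.
by rewrite corank_contraction mobius_quotient.
Qed.

(** After exchanging the two sums, the coefficient of [z^(l(X))] is the sum of
    [mu(T, X)] over [U^perp <= T <= X], which vanishes unless [X = U^perp]. *)
Lemma sum_characteristic_poly_contraction_to (p : antiautomorphism E) U :
  \sum_(A : {vspace E} | (A <= U)%VS) characteristic_poly (contraction_to M p A)
  = 'X^(corank M (p U)).
Proof.
transitivity (\sum_(T : {vspace E} | (p U <= T)%VS)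
    \sum_(X : {vspace E} | (T <= X)%VS) (mobius T X)%:P * 'X^(corank M X)).
  rewrite [RHS](reindex_inj (inv_inj (perpK p))) /=.
  apply: eq_big => [A|A _]; last exact: characteristic_poly_contraction.
  by apply/idP/idP => /(perpS p); rewrite ?perpK.
rewrite (exchange_big_dep (fun X => p U <= X)%VS) /=; last first.
  by move=> T X; apply: subv_trans.
rewrite (bigD1 (p U)) ?subvv //= -mulr_suml -rmorph_sum /=.
rewrite (sum_mobius_lower p) ?subvv // eqxx mul1r big1 ?addr0 // => X /andP[sUX neX].
rewrite -mulr_suml -rmorph_sum /= (sum_mobius_lower p) //.
by rewrite eq_sym (negPf neX) mul0r.
Qed.

Lemma corank_dual_perp (p : antiautomorphism E) U :
  (corank (dual M p) (p U))%:Z = (r * \dim U)%:Z - (M U)%:Z.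
Proof.
have pf : p fullv = 0%VS by apply/eqP; rewrite -dimv_eq0 dim_perp subnn.
have M0 : M 0%VS = 0%N by have := rank_le_dim M 0%VS; rewrite dimv0; lia.
rewrite /corank -subzn ?rank_mono ?subvf //= !dual_rankE pf perpK M0 dim_perp.
have : (r * \dim U <= r * \dim {:E})%N by rewrite leq_mul2l dimvS ?subvf ?orbT.
by rewrite mulnBr; lia.
Qed.

End CharacteristicPoly.

Theorem theorem57 (F : finFieldType) (n r : nat) (n_gt0 : (0 < n)%N)
    (r_gt0 : (0 < r)%N) (E : vectType F) (dimE : \dim (fullv : {vspace E}) = n)
    (p : antiautomorphism E) (M : polymatroid r E) (U : {vspace E}) :
  \sum_(A : {vspace E} | (A <= U)%VS)
      (characteristic_poly (contraction_to (dual M p) p A))%:F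
  = ('X : {poly int})%:F ^ ((r * \dim U)%:Z - (M fullv)%:Z)
    * \sum_(A : {vspace E} | (A <= p U)%VS)
        (characteristic_poly (contraction_to M p A))%:F
  :> {fraction {poly int}}.
Proof.
rewrite -!rmorph_sum /= !sum_characteristic_poly_contraction_to perpK !rmorphXn /=.
have X0 : ('X : {poly int})%:F != 0 by rewrite tofrac_eq0 polyX_eq0.
rewrite !exprnP -expfzDr // corank_dual_perp /corank.
by congr (_ ^ _); have := rank_mono M (subvf U); lia.
Qed.
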